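(* Let $n,N\ge1$, $q\in[0,1)$, $u_1,\dots,u_N>0$, and assume there is exactly one particle of each color $m=1,\dots,n$. Consider the $q$-Boson queue vertex model on the cylinder with weight $\mathbb W^{(-m)}_{u_j}$ at the vertex $(-m,j)$ and empty left boundary. To each path configuration associate the multiline diagram whose multiset of labels at $(-m,j)$ consists of the colors of the paths exiting $(-m,j)$ to the right. Then this mapping is weight-preserving: there is a constant $c$ (which may depend on the parameters of the model but not on the particle configuration) such that for every multiline diagram in which, for each $m$, each label in $\{m,\dots,n\}$ appears exactly once in column $-m$, the sum of the weights of all path configurations mapped to this diagram (i.e. the sum over the windings of the paths around the cylinder) equals $c$ times the weight of the multiline diagram.
   Context: **Weights.** $(a;q)_k=\prod_{i=0}^{k-1}(1-aq^i)$, $|\mathbf D|=\sum D_i$, $0^0=1$. For $1\le m\le n$, $\mathbf B,\mathbf D\in\mathbb Z_{\ge0}^n$ (entering from the left, exiting right), tuples $\mathbf A,\mathbf C$ (entering from below, exiting above) with $A_m=C_m=+\infty$ and other coordinates in $\mathbb Z_{\ge0}$, $$\mathbb W^{(-m)}_{u}(\mathbf A,\mathbf B;\mathbf C,\mathbf D)=\mathbf 1_{\mathbf A+\mathbf B=\mathbf C+\mathbf D}\mathbf 1_{D_1=\dots=D_{m-1}=0}\prod_{i=1}^n\mathbf 1_{B_i\le C_i}\;u^{|\mathbf D|}q^{\sum_{m\le i<j\le n}D_i(C_j-B_j)}\frac1{(q;q)_{D_m}}\prod_{i=m+1}^n\frac{(q;q)_{C_i-B_i+D_i}}{(q;q)_{C_i-B_i}(q;q)_{D_i}},$$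 where $\mathbf 1_{\mathbf A+\mathbf B=\mathbf C+\mathbf D}$ imposes equality in coordinates $i\neq m$. **Path configurations on the cylinder.** Vertices are $(-m,j)$, $1\le m\le n$, $j\in\mathbb Z/N\mathbb Z$. A configuration consists of $\mathbf H^{(m,j)}\in\mathbb Z_{\ge0}^n$ (paths exiting $(-m,j)$ to the right; $\mathbf H^{(n+1,j)}=\mathbf 0$) and vertical tuples $\mathbf A^{(m,j)}$ ($j$ cyclic mod $N$) with $(\mathbf A^{(m,j)})_m=+\infty$, $(\mathbf A^{(m,j)})_i=0$ for $i<m$, $(\mathbf A^{(m,j)})_i\in\mathbb Z_{\ge0}$ for $i>m$; its weight is $\prod_{m,j}\mathbb W^{(-m)}_{u_j}(\mathbf A^{(m,j)},\mathbf H^{(m+1,j)};\mathbf A^{(m,j+1)},\mathbf H^{(m,j)})$. **Multiline diagrams.** A (strict) multiline diagram assigns to each vertex $(-m,j)$ of the cylinder a multiset of labels such that all labels in column $-m$ lie in $\{m,\dots,n\}$; the combined multiset of labels in column $-m$ is obtained from that in column $-(m+1)$ by adding some new labels $m$; and each label $m$ appears at most once in each of the columns $-m,-(m-1),\dots,-1$ (here, exactly once). Let $p_r(-m)\in\mathbb Z/N\mathbb Z$ be the position of label $r$ in column $-m$. The weight of the diagram is $q^{\mathfrak R}u_1^{c_1}\cdots u_N^{c_N}$, where $c_j$ is the total number of labels in row $j$ (over all columns) and $\mathfrak R=\sum_{m=2}^nR_m$ with $$R_m=\sum_{m-1\le k<\ell\le n}\mathbf 1\bigl[p_\ell(-(m-1))>p_k(-(m-1))>p_\ell(-m)\bigr].$$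 Here the event $a>b>c$ for positions on the ring means that, reading from $a$ in the direction of decreasing positions until reaching $c$, the position $b$ is encountered strictly between $a$ and $c$; if $a=c$, this is understood as one full loop, so the event holds iff $b\ne a$. *)

(* Defs.v *)
From mathcomp Require Import all_boot all_order all_algebra.
From mathcomp Require Import finmap multiset.
From mathcomp Require Import all_classical all_reals all_analysis.

Set Implicit Arguments.
Unset Strict Implicit.
Unset Printing Implicit Defensive.

Import Order.TTheory GRing.Theory Num.Theory.

Local Open Scope nat_scope.

(* Indexing is 0-based: m : 'I_n stands for the colour (or label) m+1, and also
   for the column -(m+1), so that ordS m is the next column to the left and
   ord_pred m the next one to the right; j : 'I_N stands for the row j+1, seen
   as an element of the cyclic group Z/NZ, with ordS j its upper neighbour. *)

(* Tuples indexed by colours. None encodes the coordinate +oo. *)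
Definition htuple (n : nat) := {ffun 'I_n -> nat}.
Definition vtuple (n : nat) := {ffun 'I_n -> option nat}.

Definition xaddn (x : option nat) (b : nat) : option nat :=
  omap (fun a => a + b) x.
Definition leq_x (b : nat) (x : option nat) : bool :=
  if x is Some c then b <= c else true.
(* Only used on finite coordinates; +oo is sent to a dummy value. *)
Definition finite_part (x : option nat) : nat := odflt 0 x.

Section Weights.
Variable R : realType.
Local Open Scope ring_scope.

Definition qpoch (a q : R) (k : nat) : R := \prod_(i < k) (1 - a * q ^+ i).

(* The weight of a vertex of the column m, for tuples with A m = C m = +oo.
   Below, C i is finite whenever C i - B i is evaluated, and the truncated
   subtraction is exact when the indicator of B <= C does not vanish. *)
Definition vertex_weight (n : nat) (q u : R) (m : 'I_n)
    (A : vtuple n) (B : htuple n) (C : vtuple n) (D : htuple n) : R :=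
  let CB (i : 'I_n) := (finite_part (C i) - B i)%N in
  [forall i : 'I_n, (i != m) ==> (xaddn (A i) (B i) == xaddn (C i) (D i))]%:R
  * [forall i : 'I_n, (i < m)%N ==> (D i == 0%N)]%:R
  * (\prod_(i < n) (leq_x (B i) (C i))%:R)
  * u ^+ (\sum_(i < n) D i)
  * q ^+ (\sum_(i < n | (m <= i)%N) \sum_(j < n | (i < j)%N) D i * CB j)%N
  * (qpoch q q (D m))^-1
  * \prod_(i < n | (m < i)%N)
      (qpoch q q (CB i + D i) / (qpoch q q (CB i) * qpoch q q (D i))).

End Weights.

(* x.1 (m, j) are the paths exiting the vertex (m, j) to the right and
   x.2 (m, j) is the vertical tuple entering that vertex from below. *)
Definition path_config (n N : nat) : Type :=
  ({ffun 'I_n * 'I_N -> htuple n} * {ffun 'I_n * 'I_N -> vtuple n})%type.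

Definition is_path_config (n N : nat) (x : path_config n N) : Prop :=
  forall (m : 'I_n) (j : 'I_N) (i : 'I_n),
    [/\ i = m -> x.2 (m, j) i = None,
        (i < m)%N -> x.2 (m, j) i = Some 0
      & (m < i)%N -> exists a : nat, x.2 (m, j) i = Some a].

(* The paths entering (m, j) from the left: those exiting the column to the
   left of m, and none for the leftmost column (empty left boundary). *)
Definition entering (n N : nat) (x : path_config n N) (m : 'I_n) (j : 'I_N) :
    htuple n :=
  if m.+1 < n then x.1 (ordS m, j) else [ffun=> 0].

Definition config_weight (R : realType) (n N : nat) (q : R) (u : 'I_N -> R)
    (x : path_config n N) : R :=
  (\prod_(m < n) \prod_(j < N)
     vertex_weight q (u j) m
       (x.2 (m, j)) (entering x m j) (x.2 (m, ordS j)) (x.1 (m, j)))%R.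

Definition labelling (n N : nat) : Type := {ffun 'I_n * 'I_N -> {mset 'I_n}%mset}.

Definition column (n N : nat) (M : labelling n N) (m : 'I_n) : {mset 'I_n}%mset :=
  \big[@msetD 'I_n/@mset0 'I_n]_(j < N) M (m, j).

Definition left_column (n N : nat) (M : labelling n N) (m : 'I_n) :
    {mset 'I_n}%mset :=
  if m.+1 < n then column M (ordS m) else mset0.

Definition is_multiline_diagram (n N : nat) (M : labelling n N) : Prop :=
  [/\ forall (m : 'I_n) (j : 'I_N) (r : 'I_n), r \in M (m, j) -> m <= r,
      forall m : 'I_n,
        exists k : nat, column M m = msetD (left_column M m) (msetn k m)
    & forall m r : 'I_n, m <= r -> column M m r <= 1].

(* Each of the labels m, ..., n appears exactly once in the column -m. *)
Definition one_of_each_label (n N : nat) (M : labelling n N) : Prop :=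
  forall m r : 'I_n, m <= r -> column M m r = 1.

(* The diagram of a configuration: at each vertex, the colours of the paths
   exiting to the right, listed with multiplicity. *)
Definition labelling_of (n N : nat) (x : path_config n N) : labelling n N :=
  [ffun v => seq_mset (flatten [seq nseq (x.1 v i) i | i <- enum 'I_n])].

(* The row of the label r in the column m; the default value, which is where
   0 < N is used, is irrelevant when the label is present. *)
Definition position (n N : nat) (hN : 0 < N) (M : labelling n N) (m r : 'I_n) :
    'I_N :=
  odflt (Ordinal hN) [pick j : 'I_N | r \in M (m, j)].

(* Number of steps in the direction of decreasing positions from a to b, taken
   in 0, ..., N-1. *)
Definition steps_down (N : nat) (a b : 'I_N) : nat := (a + (N - b)) %% N.

(* a > b > c on the ring; when c = a the walk from a to c is a full loop. *)
Definition ring_gt (N : nat) (a b c : 'I_N) : bool :=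
  0 < steps_down a b < (if a == c then N else steps_down a c).

(* For a column m other than the rightmost one. *)
Definition R_stat (n N : nat) (hN : 0 < N) (M : labelling n N) (m : 'I_n) : nat :=
  let m' := ord_pred m in
  \sum_(k < n | m' <= k) \sum_(l < n | k < l)
    ring_gt (position hN M m' l) (position hN M m' k) (position hN M m l).

Definition labelling_weight (R : realType) (n N : nat) (hN : 0 < N) (q : R)
    (u : 'I_N -> R) (M : labelling n N) : R :=
  (q ^+ (\sum_(m < n | 0 < m) R_stat hN M m)%N
   * \prod_(j < N) u j ^+ (\sum_(m < n) size (M (m, j)))%N)%R.

(* Main.v *)
(* The labelling determines all horizontal edges, so that only the windings
   remain free. In the column m, the path of a colour l > m enters in row
   a = p_l(m+1) and leaves in row b = p_l(m), hence
     C_l - B_l = w + 1[b > j > a]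
   in row j, for some w >= 0, and every w occurs. A path of colour i >= m leaving
   in row j = p_i(m) thus contributes q^w times the term of the statistic for
   the pair (i, l); there are l - m such i < l, and the q-binomial of colour l
   is (1 - q^(w+1)) / (1 - q) in row b and 1 elsewhere. The weights therefore
   factorise, and the sum over each w is a convergent series in
   q^((l-m) w) (1 - q^(w+1)) / (1 - q) which does not depend on the diagram. *)
Require Import Defs.
From mathcomp Require Import all_boot all_order all_algebra.
From mathcomp Require Import finmap multiset.
From mathcomp Require Import all_classical all_reals all_analysis.
From mathcomp Require Import zify ring.
Import Order.TTheory GRing.Theory Num.Theory numFieldNormedType.Exports.
Local Open Scope classical_set_scope.
Local Open Scope ring_scope.

(** * Sums of product weights over functions on a finite index set *)

Lemma sum_ffun_box (R : realType) (I : finType) (K : nat) (C : R)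
    (f : I -> nat -> R) :
  (\sum_(w \in [set (finfun (fun i => val (v i)) : {ffun I -> nat})
                | v in [set: {ffun I -> 'I_K}]]) (C * \prod_i f i (w i))%:E)%E
  = (C * \prod_i series (f i) K)%:E.
Proof.
rewrite fsbig_image /=; last first.
  move=> v v' _ _ /ffunP vv'; apply/ffunP => i; apply: val_inj.
  by have := vv' i; rewrite !ffunE.
rewrite (_ : setT = [set` index_enum {ffun I -> 'I_K}]); last first.
  by apply/seteqP; split=> v //= _; rewrite mem_index_enum.
rewrite -fsbig_seq ?index_enum_uniq// sumEFin; rewrite -mulr_sumr; congr ((C * _)%:E).
under [RHS]eq_bigr => i _ do rewrite /series /= big_mkord.
rewrite bigA_distr_bigA /=; apply: eq_bigr => v _.
by apply: eq_bigr => i _; rewrite ffunE.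
Qed.

Lemma finite_subset_ffun_box (I : finType) (X : set {ffun I -> nat}) :
  finite_set X ->
  exists K, X `<=` [set (finfun (fun i => val (v i)) : {ffun I -> nat})
                    | v in [set: {ffun I -> 'I_K}]].
Proof.
move=> finX.
exists (\max_(w <- fset_set X) \max_i w i).+1 => w Xw.
have wK i : (w i < (\max_(w <- fset_set X) \max_i w i).+1)%N.
  rewrite ltnS; apply: (leq_trans (leq_bigmax i)).
  by apply: (@leq_bigmax_seq _ _ _ (fun w : {ffun I -> nat} => \max_i w i)%N);
    rewrite // in_fset_set// mem_set.
by exists [ffun i => Ordinal (wK i)] => //; apply/ffunP => i; rewrite !ffunE.
Qed.

(** The terms are nonnegative, so the sum is the supremum of its finite partial sums. Every finite
    set of functions lies in a box of functions with values below some [K], and over a box the sum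
    factorises by distributivity. *)
Lemma esum_prod_series (R : realType) (I : finType) (C : R) (f : I -> nat -> R)
    (s : I -> R) :
  0 <= C -> (forall i k, 0 <= f i k) ->
  (forall i, (series (f i) K @[K --> \oo] --> s i)) ->
  \esum_(w in [set: {ffun I -> nat}]) (C * \prod_i f i (w i))%:E
  = (C * \prod_i s i)%:E.
Proof.
move=> C0 f0 fs.
have f0' (w : {ffun I -> nat}) : (0 <= (C * \prod_i f i (w i))%:E)%E.
  by rewrite lee_fin mulr_ge0//; apply: prodr_ge0 => i _.
have serf K i : 0 <= series (f i) K by rewrite /series /=; apply: sumr_ge0.
pose P K := C * \prod_i series (f i) K.
have P_cvg : P K @[K --> \oo] --> C * \prod_i s i.
  apply: cvgM; first exact: cvg_cst.
  apply: cvg_big => [|i _]; last exact: fs.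
  by move=> x; apply: mul_continuous.
have ndP : nondecreasing_seq P.
  move=> K K' KK'; apply: ler_wpM2l => //; apply: ler_prod => i _; rewrite serf /=.
  by apply: nondecreasing_series => // k _ _; exact: f0.
have Ple K : P K <= C * \prod_i s i.
  by rewrite -(cvg_lim _ P_cvg)//; apply: nondecreasing_cvgn_le => //; exact: cvgP P_cvg.
have finbox K : finite_set [set (finfun (fun i => val (v i)) : {ffun I -> nat})
                    | v in [set: {ffun I -> 'I_K}]].
  exact/finite_image/finite_finset.
apply/eqP; rewrite eq_le; apply/andP; split.
  apply: ge_ereal_sup => _ [X [finX _]] <-.
  have [K XK] := finite_subset_ffun_box _ _ finX.
  apply: (@le_trans _ _ (P K)%:E); last by rewrite lee_fin.
  rewrite -sum_ffun_box; apply: lee_fsum_nneg_subset => //.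
  exact/subsetP.
have PK K : ((P K)%:E <= \esum_(w in [set: {ffun I -> nat}]) (C * \prod_i f i (w i))%:E)%E.
  rewrite -sum_ffun_box; apply: esum_ge.
  by exists [set (finfun (fun i => val (v i)) : {ffun I -> nat})
                    | v in [set: {ffun I -> 'I_K}]].
move: PK; case: (esum _ _) => [r| |] PK; last 2 first.
- by rewrite leey.
- by have := PK 0%N; rewrite leeNy_eq.
rewrite lee_fin -(cvg_lim _ P_cvg)//; apply: limr_le; first exact: cvgP P_cvg.
by near=> K; rewrite -lee_fin.
Unshelve. all: by end_near.
Qed.

(** * Cyclic order of the rows and vertical occupation numbers *)

(** As [j] moves up by one row, the event can only switch on when leaving [a] and off when reaching
    [b]. This is the conservation law of a path entering at [a] and leaving at [b]. *)
Lemma ring_gt_step (N : nat) (a b j : 'I_N) :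
  (ring_gt b j a + (j == a) = ring_gt b (ordS j) a + (ordS j == b))%N.
Proof.
have steps_downE (c d : 'I_N) :
    (steps_down c d = if d <= c then c - d else c + N - d)%N.
  case: (leqP d c) => cd; have := ltn_ord c; have := ltn_ord d => ? ?.
    by rewrite /steps_down (_ : c + (N - d) = c - d + N)%N ?modnDr ?modn_small; lia.
  by rewrite /steps_down modn_small; lia.
rewrite /ring_gt !steps_downE -!(inj_eq val_inj) /=.
have := ltn_ord a; have := ltn_ord b; have := ltn_ord j => jN bN aN.
have [jN1|jN1] := ltnP j.+1 N.
  rewrite modn_small//; case: (eqVneq (b : nat) a) => ba; repeat case: ifP.
  all: try lia.
have -> : j.+1 = N by lia.
rewrite modnn leq0n subn0; case: (eqVneq (b : nat) a) => ba; repeat case: ifP.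
all: lia.
Qed.

Lemma ring_gt_mid (N : nat) (a b : 'I_N) : ring_gt b b a = false.
Proof. by rewrite /ring_gt /steps_down subnKC ?modnn// ltnW. Qed.

Lemma ordS_invariant (T : Type) (N : nat) (f : 'I_N -> T) :
  (forall j, f (ordS j) = f j) -> forall i j, f i = f j.
Proof.
move=> fS; suff f0 (j : 'I_N) (h : (0 < N)%N) : f j = f (Ordinal h).
  move=> i j; have h : (0 < N)%N := leq_ltn_trans (leq0n i) (ltn_ord i).
  by rewrite (f0 i h) (f0 j h).
case: j => k; elim: k => [|k IHk] kN; first by congr f; apply: val_inj.
rewrite -(IHk (ltnW kN)) -[RHS]fS; congr f; apply: val_inj => /=.
by rewrite modn_small.
Qed.

(* [A j] counts the paths of one colour on the vertical edge below row [j] of a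
   column which such a path enters at [a] and leaves at [b]. *)
Lemma occupation_ring_gt (N : nat) (a b : 'I_N) (A : 'I_N -> nat) :
  (forall j, A j + (j == a) = A (ordS j) + (j == b))%N ->
  (forall j, (j == a) <= A (ordS j))%N ->
  forall j, (A j = A b - 1 + ring_gt b j a + (j == b))%N.
Proof.
move=> AS Aa j.
(* By [AS] and [ring_gt_step] this difference is invariant under [ordS]; integers avoid truncated
   subtraction. *)
have /(_ j b) : forall i k, (A i : int) - (ring_gt b i a + (i == b))%N%:Z
    = (A k : int) - (ring_gt b k a + (k == b))%N%:Z.
  apply: ordS_invariant => i.
  by have := AS i; have := ring_gt_step _ a b i; lia.
(* [AS b] and [Aa b] together give [0 < A b], so [A b - 1] is exact. *)
have := AS b; have := Aa b; rewrite ring_gt_mid eqxx; lia.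
Qed.

(** * Multiplicities of labels in a diagram *)

Lemma count_flatten_nseq (n : nat) (h : 'I_n -> nat) (i : 'I_n) :
  count_mem i (flatten [seq nseq (h k) k | k <- enum 'I_n]) = h i.
Proof.
rewrite count_flatten -map_comp sumnE big_map big_enum /= (bigD1 i)//= big1.
  by rewrite addn0 count_nseq /= eqxx mul1n.
by move=> k ki; rewrite count_nseq /= (negPf ki) mul0n.
Qed.

Lemma labelling_ofP (n N : nat) (x : path_config n N) (M : labelling n N) :
  labelling_of x = M <-> forall v i, x.1 v i = M v i.
Proof.
split=> [<- v i|xM]; first by rewrite ffunE mset_seqE count_flatten_nseq.
apply/ffunP => v; apply/msetP => i.
by rewrite ffunE mset_seqE count_flatten_nseq.
Qed.

Lemma columnE (n N : nat) (M : labelling n N) (m r : 'I_n) :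
  column M m r = (\sum_(j < N) M (m, j) r)%N.
Proof.
rewrite /column; elim/big_rec2: _ => [|j k A _ IH]; first by rewrite mset0E.
by rewrite msetE2 IH.
Qed.

Lemma size_mset_ord (n : nat) (A : {mset 'I_n}%mset) :
  size A = (\sum_(i < n) A i)%N.
Proof.
rewrite size_mset [RHS](bigID (mem (finsupp A)))/= [X in (_ = _ + X)%N]big1 ?addn0.
  by rewrite big_uniq ?fset_uniq.
by move=> i; apply: fsfun_dflt.
Qed.

Lemma diagram_mult_low (n N : nat) (M : labelling n N) (m : 'I_n) (j : 'I_N)
    (r : 'I_n) :
  is_multiline_diagram M -> (r < m)%N -> M (m, j) r = 0%N.
Proof.
case=> Mm _ _ rm; apply/eqP; rewrite -leqn0 leqNgt -in_mset.
by apply/negP => /Mm; rewrite leqNgt rm.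
Qed.

Lemma diagram_mult (n N : nat) (hN : (0 < N)%N) (M : labelling n N)
    (m : 'I_n) (j : 'I_N) (r : 'I_n) :
  one_of_each_label M -> (m <= r)%N ->
  M (m, j) r = (j == position hN M m r) :> nat.
Proof.
move=> M1 mr; have := M1 _ _ mr; rewrite columnE => S1.
have le1 k : (M (m, k) r <= 1)%N by rewrite -S1 (bigD1 k)//= leq_addr.
have one k k' : (0 < M (m, k) r)%N -> (0 < M (m, k') r)%N -> k = k'.
  move=> k0 k'0; apply/eqP/negPn/negP => kk'.
  suff : (1 < \sum_(i < N) M (m, i) r)%N by rewrite S1.
  rewrite (bigD1 k)//= (bigD1 k') 1?eq_sym//= addnA.
  by apply: leq_trans (leq_addr _ _); rewrite -[2%N]/(1 + 1)%N leq_add.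
rewrite /position; case: pickP => [k|no]; rewrite /= ?in_mset.
  move=> k0; have [->|jk] := eqVneq j k; first by apply/eqP; rewrite eqn_leq le1.
  by apply/eqP; rewrite -[_ == _]negbK -lt0n; apply: contra jk => j0; exact/eqP/one.
move: S1; rewrite big1// => k _; have := no k; rewrite in_mset lt0n => /negbFE.
by move=> /eqP.
Qed.

(** * q-binomials and the convergent series over one winding number *)

Lemma qpoch_neq0 (R : realType) (q : R) (k : nat) :
  0 <= q < 1 -> qpoch q q k != 0.
Proof.
move=> /andP[q0 q1]; apply/prodf_neq0 => i _.
by rewrite -exprS subr_eq0 eq_sym lt_eqF// exprn_ilt1.
Qed.

Lemma qpoch_bool (R : realType) (q : R) (b : bool) :
  qpoch q q b = if b then 1 - q else 1.
Proof.
by case: b; rewrite /qpoch ?big_ord0// big_ord1 expr0 mulr1.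
Qed.

(** Each label occurs once per column, so at most one path of a given colour leaves a vertex and
    only these two q-binomials arise. *)
Lemma qbinom_bool (R : realType) (q : R) (k : nat) (b : bool) : 0 <= q < 1 ->
  qpoch q q (k + b)%N / (qpoch q q k * qpoch q q b)
  = if b then (1 - q ^+ k.+1) / (1 - q) else 1.
Proof.
move=> hq; rewrite qpoch_bool; have qk := qpoch_neq0 _ _ k hq.
case: b; rewrite ?addn0 ?mulr1 ?divff//.
rewrite addn1 /qpoch big_ord_recr/= -/(qpoch q q k) -exprS invfM mulrACA.
by rewrite divff// mul1r.
Qed.

(* The contribution of a path of colour [p.2] crossing the column [p.1] which
   winds [k] extra times; pairs not describing a crossing path only allow
   [k = 0]. *)
Definition winding_weight (R : realType) (n : nat) (q : R) (p : 'I_n * 'I_n)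
    (k : nat) : R :=
  if (p.1 < p.2)%N then q ^+ ((p.2 - p.1) * k) * ((1 - q ^+ k.+1) / (1 - q))
  else (k == 0)%:R.

Lemma winding_weight_ge0 (R : realType) (n : nat) (q : R) (p : 'I_n * 'I_n) k :
  0 <= q < 1 -> 0 <= winding_weight R n q p k.
Proof.
move=> /andP[q0 q1]; rewrite /winding_weight; case: ifP => // _.
rewrite mulr_ge0 ?exprn_ge0// divr_ge0// subr_ge0 ?exprn_ile1//; exact: ltW.
Qed.

Lemma winding_weight_series_cvg (R : realType) (n : nat) (q : R)
    (p : 'I_n * 'I_n) :
  0 <= q < 1 -> cvgn (series (winding_weight R n q p)).
Proof.
move=> /andP[q0 q1]; rewrite /winding_weight; case: ltnP => [p12|_]; last first.
  apply/cvg_ex; exists 1; apply: cvg_near_cst; near=> K.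
  rewrite /series/= (@big_ltn _ _ _ 0 K); last by near: K; exact: nbhs_infty_gt.
  by rewrite big_nat_cond big1 ?addr0// => -[|k].
have [d0 d1] : (0 < p.2 - p.1 /\ 0 < (p.2 - p.1).+1)%N by rewrite subn_gt0.
set d := (p.2 - p.1)%N in d0 d1 *.
(* Expanding 1 - q^(k+1) splits the term into two geometric ones, with ratios q^d and q^(d+1), both
   below 1 since d > 0. *)
rewrite (_ : series _ = series (geometric (1 - q)^-1 (q ^+ d))
                        - series (geometric (q / (1 - q)) (q ^+ d.+1))).
  apply: is_cvgB; apply: is_cvg_geometric_series;
    by rewrite ger0_norm ?exprn_ge0// exprn_ilt1// -lt0n.
apply/funext => K; rewrite /series/= fctE -sumrB; apply: eq_bigr => k _ /=.
by rewrite -!exprM mulSn exprD exprS; ring.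
Unshelve. all: by end_near.
Qed.
(* The path of colour [r], in its shortest form, goes vertically through the
   vertex [(m, j)] without stopping there. *)
Definition passes (n N : nat) (hN : (0 < N)%N) (M : labelling n N)
    (m r : 'I_n) (j : 'I_N) : bool :=
  ring_gt (position hN M m r) j (position hN M (ordS m) r).

Arguments passes {n N}.

(** The vertical occupation is the one found in [occupation_ring_gt]: [w] extra turns, one path
    where the shortest form passes, and one in the exit row, which is always reached from below. *)
Definition winding_config (n N : nat) (hN : (0 < N)%N) (M : labelling n N)
    (w : {ffun 'I_n * 'I_n -> nat}) : path_config n N :=
  ([ffun v : 'I_n * 'I_N => [ffun i : 'I_n => M v i]],
   [ffun v : 'I_n * 'I_N => [ffun i : 'I_n =>
     if i == v.1 then None else if (i < v.1)%N then Some 0%N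
     else Some (w (v.1, i) + passes hN M v.1 i v.2
                + (v.2 == position hN M v.1 i))%N]]).

Arguments winding_config {n N}.

(* Only colours [i > m] have a finite vertical occupation number in the column
   [m]; the other entries carry no information and are set to zero. *)
Definition windings (n : nat) : set {ffun 'I_n * 'I_n -> nat} :=
  [set w | forall p : 'I_n * 'I_n, (p.2 <= p.1)%N -> w p = 0%N].

(** * Configurations above a fixed diagram and their weights *)

Section Diagram.
Variables (R : realType) (n N : nat) (hN : (0 < N)%N).
Variables (q : R) (u : 'I_N -> R) (M : labelling n N).
Hypotheses (hq : 0 <= q < 1) (diagM : is_multiline_diagram M).
Hypothesis labelM : one_of_each_label M.

Let pos := position hN M.

Lemma exiting_diagram (x : path_config n N) (m : 'I_n) (j : 'I_N) (i : 'I_n) :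
  labelling_of x = M -> x.1 (m, j) i = (m <= i)%N && (j == pos m i) :> nat.
Proof.
move=> /labelling_ofP ->; case: leqP => [mi|im]; first exact: diagram_mult.
exact: diagram_mult_low.
Qed.

Lemma entering_diagram (x : path_config n N) (m : 'I_n) (j : 'I_N) (i : 'I_n) :
  labelling_of x = M ->
  entering x m j i = (m < i)%N && (j == pos (ordS m) i) :> nat.
Proof.
move=> xM; rewrite /entering; case: ltnP => [mn|nm]; last first.
  by rewrite ffunE ltnNge -ltnS (leq_trans (ltn_ord i)).
by rewrite exiting_diagram //= modn_small.
Qed.

Lemma labelling_of_winding_config w : labelling_of (winding_config hN M w) = M.
Proof. by apply/labelling_ofP => v i; rewrite !ffunE. Qed.

Lemma is_path_config_winding_config w : is_path_config (winding_config hN M w).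
Proof.
move=> m j i; rewrite !ffunE /=; split=> [->|im|mi]; first by rewrite eqxx.
  by rewrite -(inj_eq val_inj) ltn_eqF// im.
rewrite -(inj_eq val_inj) gtn_eqF// ltnNge ltnW//=.
by eexists.
Qed.

Lemma winding_config_inj :
  set_inj (windings n) (winding_config hN M).
Proof.
move=> w w'; rewrite !inE /= => w0 w'0 [/ffunP ww']; apply/ffunP => -[m i].
have [im|mi] := leqP i m; first by rewrite w0// w'0.
have /ffunP/(_ i) := ww' (m, pos m i).
rewrite !ffunE /= -(inj_eq val_inj) gtn_eqF// ltnNge ltnW//= => -[].
by move=> /addIn/addIn.
Qed.

Lemma config_weight_neq0 (x : path_config n N) :
  is_path_config x -> labelling_of x = M -> config_weight q u x != 0 ->
  exists2 w, windings n w & winding_config hN M w = x.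
Proof.
move=> xP xM /prodf_neq0 wx.
pose A (m i : 'I_n) j := finite_part (x.2 (m, j) i).
(* The winding number is the occupation below the exit row, minus the path that leaves there. *)
exists [ffun p : 'I_n * 'I_n =>
  if (p.1 < p.2)%N then (A p.1 p.2 (pos p.1 p.2) - 1)%N else 0%N].
  by move=> p; rewrite ffunE leqNgt; case: ltnP.
rewrite [RHS]surjective_pairing; congr pair.
  by apply/ffunP => v; apply/ffunP => i; rewrite !ffunE; move/labelling_ofP: xM.
apply/ffunP => -[m j]; apply/ffunP => i; rewrite !ffunE /=.
case: (xP m j i) => xi_eq xi_lt xi_gt.
have [im|im] := eqVneq i m; first by rewrite xi_eq.
have [im'|mi] := ltnP i m; first by rewrite xi_lt.
have {im xi_eq xi_lt}mi : (m < i)%N by rewrite ltn_neqAle eq_sym (inj_eq val_inj) im.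
have Am k : x.2 (m, k) i = Some (A m i k).
  by case: (xP m k i) => _ _ /(_ mi) [a xa]; rewrite /A xa.
have wm k : vertex_weight q (u k) m (x.2 (m, k)) (entering x m k)
     (x.2 (m, ordS k)) (x.1 (m, k)) != 0.
  by have /prodf_neq0 := wx m isT; apply.
(* A nonzero weight forces the indicators of A + B = C + D and of B <= C to hold; these are the two
   hypotheses of [occupation_ring_gt]. *)
have [AS Aa] : (forall k, A m i k + (k == pos (ordS m) i)
      = A m i (ordS k) + (k == pos m i))%N /\
    (forall k, (k == pos (ordS m) i) <= A m i (ordS k))%N.
  split=> k; have := wm k; rewrite /vertex_weight !mulf_eq0 !negb_or.
    case/andP => /andP[/andP[/andP[/andP[/andP[+ _] _] _] _] _] _.
    case: forallP => [/(_ i)|]; last by rewrite eqxx.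
    rewrite -(inj_eq val_inj) gtn_eqF//= !Am exiting_diagram// entering_diagram//.
    by rewrite mi (ltnW mi) => /eqP[].
  case/andP => /andP[/andP[/andP[/andP[_ +] _] _] _] _.
  move=> /prodf_neq0/(_ i isT); rewrite Am /= entering_diagram// mi /=.
  by case: leqP => //; rewrite eqxx.
by rewrite mi Am /passes -(occupation_ring_gt _ _ _ _ AS Aa).
Qed.

Lemma vertex_weight_winding_config w (m : 'I_n) (j : 'I_N) :
  let x := winding_config hN M w in
  vertex_weight q (u j) m (x.2 (m, j)) (entering x m j) (x.2 (m, ordS j))
    (x.1 (m, j))
  = u j ^+ size (M (m, j))
    * q ^+ (\sum_(i < n | (m <= i)%N) \sum_(l < n | (i < l)%N)
              (j == pos m i) * (w (m, l) + passes hN M m l j))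
    * (if j == pos m m then 1 - q else 1)^-1
    * \prod_(i < n | (m < i)%N)
        (if j == pos m i then (1 - q ^+ (w (m, i)).+1) / (1 - q) else 1).
Proof.
move=> x; have xM : labelling_of x = M := labelling_of_winding_config w.
(* By [ring_gt_step] the tuple above row [j] is expressed through [passes] in row [j] itself, so
   that the entering path cancels in C - B. *)
have x2S (i : 'I_n) : (m < i)%N -> x.2 (m, ordS j) i =
    Some (w (m, i) + passes hN M m i j + (j == pos (ordS m) i))%N.
  move=> mi; rewrite !ffunE /= -(inj_eq val_inj) gtn_eqF// ltnNge ltnW//=.
  by rewrite -!addnA; congr (Some (_ + _)%N); rewrite ring_gt_step.
have CB (i : 'I_n) : (m < i)%N ->
    (finite_part (x.2 (m, ordS j) i) - entering x m j i
     = w (m, i) + passes hN M m i j)%N.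
  by move=> mi; rewrite x2S//= entering_diagram// mi addnK.
have D (i : 'I_n) : (m <= i)%N -> x.1 (m, j) i = (j == pos m i) :> nat.
  by move=> mi; rewrite exiting_diagram// mi.
rewrite /vertex_weight.
have -> : [forall i : 'I_n, (i != m) ==>
    (xaddn (x.2 (m, j) i) (entering x m j i)
     == xaddn (x.2 (m, ordS j) i) (x.1 (m, j) i))].
  apply/forallP => i; apply/implyP => im.
  have [mi|im'] := ltnP m i.
    rewrite x2S// entering_diagram// D ?(ltnW mi)// mi /=.
    rewrite !ffunE /= (negPf im) ltnNge ltnW//=; apply/eqP; congr Some.
    exact: addnAC.
  have {im'}im' : (i < m)%N by rewrite ltn_neqAle im' (inj_eq val_inj) im.
  rewrite entering_diagram// exiting_diagram// ltnNge (ltnW im') leqNgt im'.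
  by rewrite !ffunE /= (negPf im) im'.
have -> : [forall i : 'I_n, (i < m)%N ==> (x.1 (m, j) i == 0%N)].
  apply/forallP => i; apply/implyP => im.
  by rewrite exiting_diagram// leqNgt im.
rewrite [X in _ * X * _ * _ * _ * _]big1 ?mulr1 ?mul1r; last first.
  move=> i _; rewrite entering_diagram//; case: ltnP => [mi|im] /=.
    by rewrite x2S//= leq_addl.
  by case: (x.2 _ _).
rewrite D// qpoch_bool; congr (_ * _ * _ * _).
- congr (_ ^+ _); rewrite size_mset_ord; apply: eq_bigr => i _.
  by move/labelling_ofP: xM => ->.
- congr (_ ^+ _); apply: eq_bigr => i mi; apply: eq_bigr => l il.
  by rewrite D// CB// (leq_ltn_trans mi il).
apply: eq_bigr => i mi; rewrite CB// D ?(ltnW mi)//.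
(* In the exit row [passes] is false, so there C - B is exactly the winding number. *)
rewrite qbinom_bool//; case: eqP => // ->.
by rewrite /passes ring_gt_mid addn0.
Qed.

(** Each [l] is counted once for every [i] with m <= i < l; this produces the exponent in
    [winding_weight]. *)
Lemma sum_above_diag (m : 'I_n) (f : 'I_n -> nat) :
  (\sum_(i < n | (m <= i)%N) \sum_(l < n | (i < l)%N) f l
   = \sum_(l < n | (m < l)%N) (l - m) * f l)%N.
Proof.
rewrite (exchange_big_dep (fun l : 'I_n => m < l)%N)/=; last first.
  by move=> i l; apply: leq_ltn_trans.
apply: eq_bigr => l ml; rewrite sum_nat_const; congr (_ * _)%N.
rewrite -sum1_card -(big_ord_widen_cond n (leq m) (fun=> 1%N) (ltnW (ltn_ord l))).
by rewrite -[RHS]muln1 -sum_nat_const_nat big_geq_mkord.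
Qed.

Lemma column_weight_winding_config w (m : 'I_n) :
  let x := winding_config hN M w in
  \prod_(j < N) vertex_weight q (u j) m (x.2 (m, j)) (entering x m j)
    (x.2 (m, ordS j)) (x.1 (m, j))
  = (\prod_(j < N) u j ^+ size (M (m, j)))
    * q ^+ (\sum_(i < n | (m <= i)%N) \sum_(l < n | (i < l)%N)
              passes hN M m l (pos m i))
    * (1 - q)^-1
    * \prod_(i < n | (m < i)%N) winding_weight R n q (m, i) (w (m, i)).
Proof.
move=> x; under eq_bigr => j _ do rewrite vertex_weight_winding_config.
rewrite !big_split /= prodrXr -!mulrA; congr (_ * _).
rewrite [in RHS]mulrCA [LHS]mulrCA; congr (_ * _).
  (* The colour [m], new in this column, contributes only in its exit row. *)
  by rewrite (bigD1 (pos m m))//= eqxx big1 ?mulr1// => j /negPf ->; rewrite invr1.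
have -> : (\sum_(j < N) \sum_(i < n | m <= i) \sum_(l < n | i < l)
      (j == pos m i) * (w (m, l) + passes hN M m l j)
    = \sum_(i < n | m <= i) \sum_(l < n | i < l) passes hN M m l (pos m i)
      + \sum_(l < n | m < l) (l - m) * w (m, l))%N.
  rewrite -sum_above_diag -big_split exchange_big; apply: eq_bigr => i mi /=.
  rewrite -big_split exchange_big; apply: eq_bigr => l il /=.
  rewrite (bigD1 (pos m i))//= eqxx mul1n big1 ?addn0 1?addnC//.
  by move=> j /negPf ->; rewrite mul0n.
rewrite exprD -mulrA; congr (_ * _); rewrite -prodrXr exchange_big -big_split.
apply: eq_bigr => i mi; rewrite /winding_weight /= mi; congr (_ * _).
by rewrite (bigD1 (pos m i))//= eqxx big1 ?mulr1// => j /negPf ->.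
Qed.

Lemma sum_R_stat :
  (\sum_(m < n | 0 < m) R_stat hN M m
   = \sum_(m < n) \sum_(i < n | m <= i) \sum_(l < n | i < l)
       passes hN M m l (pos m i))%N.
Proof.
(* The statistic is indexed by the left one of two adjacent columns, [passes] by the right one. *)
rewrite (reindex (@ordS n)) /=; last exact/onW_bij/ordS_bij.
rewrite big_mkcond; apply: eq_bigr => m _; case: ltnP => [_|m0].
  by rewrite /R_stat ordSK.
(* Here [ordS m] has wrapped around to 0, so [m] is the largest colour and no pair i < l lies above
   it. *)
apply/esym/big1 => i mi; apply: big1 => l il; exfalso.
have mn : (m.+1 < n)%N by apply: leq_trans (ltn_ord l); apply: leq_ltn_trans il.
by move: m0; rewrite modn_small.
Qed.

Lemma config_weight_winding_config w : windings n w ->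
  config_weight q u (winding_config hN M w)
  = (1 - q)^-1 ^+ n * labelling_weight hN q u M
    * \prod_p winding_weight R n q p (w p).
Proof.
move=> w0; rewrite /config_weight.
under [LHS]eq_bigr => m _ do rewrite column_weight_winding_config.
rewrite !big_split /= prodr_const card_ord prodrXr -sum_R_stat.
have -> : \prod_(m < n) \prod_(i < n | (m < i)%N)
      winding_weight R n q (m, i) (w (m, i))
    = \prod_p winding_weight R n q p (w p).
  (* The added pairs have winding number 0, hence factor 1. *)
  transitivity (\prod_(m < n) \prod_(i < n) winding_weight R n q (m, i) (w (m, i))).
    2: by rewrite pair_bigA; apply: eq_bigr => -[].
  apply: eq_bigr => m _; rewrite big_mkcond; apply: eq_bigr => i _.
  by case: ltnP => // im; rewrite /winding_weight /= ltnNge im /= w0.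
rewrite exchange_big; under eq_bigr => j _ do rewrite prodrXr.
by rewrite [X in X * _]mulrC [X in _ * X * _]mulrC.
Qed.

End Diagram.

Theorem proposition5p8 (R : realType) (n N : nat) (hn : (0 < n)%N) (hN : (0 < N)%N)
    (q : R) (hq : 0 <= q < 1) (u : 'I_N -> R) (hu : forall j : 'I_N, 0 < u j) :
  exists c : R, forall M : labelling n N,
    is_multiline_diagram M -> one_of_each_label M ->
    \esum_(x in [set x : path_config n N | is_path_config x /\ labelling_of x = M])
      (config_weight q u x)%:E
    = (c * labelling_weight hN q u M)%:E.
Proof.
have q0 : 0 <= q by case/andP: hq.
have q1 : 0 <= (1 - q)^-1 by rewrite invr_ge0 subr_ge0 ltW//; case/andP: hq.
(* One factor 1/(1 - q) comes from each column, and one series from each pair of column and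
   colour. *)
exists ((1 - q)^-1 ^+ n
        * \prod_(p : 'I_n * 'I_n) limn (series (winding_weight R n q p))).
move=> M diagM labelM.
set C := (1 - q)^-1 ^+ n * labelling_weight hN q u M.
have C0 : 0 <= C.
  rewrite !mulr_ge0 ?exprn_ge0//; apply: prodr_ge0 => j _.
  by rewrite exprn_ge0// ltW.
(* Configurations outside the image of [winding_config] have weight 0, and the image lies in the
   original index set. *)
rewrite (_ : esum _ _ = \esum_(x in winding_config hN M @` windings n)
    (config_weight q u x)%:E); last first.
  rewrite esum_mkcond [RHS]esum_mkcond; apply: eq_esum => x _.
  case: ifPn => xS; case: ifPn => xW //.
    apply/eqP; rewrite eqe; apply: contraNT xW => wx; apply/mem_set.
    have [xP xM] := set_mem xS.
    have [w w0 <-] := config_weight_neq0 _ _ _ hN _ _ _ diagM labelM _ xP xM wx.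
    by exists w.
  case/negP: xS; apply/mem_set; have [w w0 <-] := set_mem xW.
  by split; [exact: is_path_config_winding_config|exact: labelling_of_winding_config].
rewrite esum_image; last exact: winding_config_inj.
under eq_esum => w w0 do
  rewrite (config_weight_winding_config _ _ _ hN _ _ _ hq diagM labelM _ w0).
rewrite mulrAC -/C -(esum_prod_series _ _ _ (winding_weight R n q)) => [|//|p k|p];
  last 2 first.
- exact: winding_weight_ge0.
- exact: winding_weight_series_cvg.
(* The sum may run over all functions: outside [windings] some factor of the product is 0. *)
rewrite esum_mkcond; apply: eq_esum => w _; case: ifPn; rewrite // notin_setE.
move=> /existsNP[p /not_implyP[p12 /eqP wp]].
rewrite (bigD1 p)//= /winding_weight ltnNge p12 /= (negPf wp) mul0r mulr0//.
Qed.
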